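(* Let $\mathcal Y$ be the affine curve over $\mathbb Z$ defined by $$y^2=x^6+2x^5-7x^4-18x^3+2x^2+20x+9.$$ Then the set $\mathcal Y(\mathbb Z)$ of its integral points (pairs $(x,y)\in\mathbb Z^2$ satisfying the equation) is equal to $$\{(-1,\pm1),\ (0,\pm3),\ (1,\pm3),\ (-2,\pm3),\ (-4,\pm37)\}.$$ *)

(* Defs.v *)
From mathcomp Require Import all_boot all_order all_algebra.

Set Implicit Arguments.
Unset Strict Implicit.
Unset Printing Implicit Defensive.

(* Main.v *)
Require Import Defs.
From mathcomp Require Import all_boot all_order all_algebra.
From mathcomp Require Import zify ring.

(** The sextic is monic of even degree, so Runge's method applies: it differs
    from the square of an integral cubic by a polynomial of lower degree, here
    one that even factors,
      [f = g ^ 2 - 4 d] with [g = x ^ 3 + x ^ 2 - 4 x - 5]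
      and [d = (x + 1) (x + 4)].
    If [y ^ 2 = g ^ 2 - 4 d] and [d <> 0], then [4 d] is a difference of two
    distinct squares of the same parity, and such a difference cannot be small
    compared with [g]: [|g| <= |d| + 1] ([diff_squares_bound]). A cubic exceeds
    a quadratic outside a bounded range, here outside [-4 <= x <= 3]
    ([runge_range]), and each remaining abscissa is checked by hand. The roots
    [-1] and [-4] of [d] give the points with [y = g] or [y = - g]. *)

Set Implicit Arguments.
Unset Strict Implicit.
Unset Printing Implicit Defensive.
Import GRing.Theory.
Local Open Scope ring_scope.

(** The factors [g - y] and [g + y] of [4 d] have the same parity, hence are
    [2 a] and [2 b] with [a b = d]. Then [g = a + b], and
    [(|a| - 1) (|b| - 1) >= 0] gives [|a| + |b| <= |a b| + 1]. *)
Lemma diff_squares_bound (g y d : int) :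
  d != 0 -> y ^+ 2 = g ^+ 2 - 4 * d -> `|g| <= `|d| + 1.
Proof.
move=> d_neq0 eq_y.
have [a def_a] : exists a : int, g - y = 2 * a.
  (* an odd [g - y] would make [g ^ 2 - y ^ 2] odd *)
  exists ((g - y) %/ 2)%Z; nia.
have def_g : g = y + 2 * a by lia.
have def_d : d = a * (y + a).
  by apply: (@mulfI _ (4 : int)) => //; move: eq_y; rewrite def_g; lia.
have [b def_b] : exists b : int, b = y + a by exists (y + a).
have g_sum : g = a + b by lia.
rewrite -def_b in def_d.
move: d_neq0; rewrite def_d mulf_eq0 negb_or => /andP[a_neq0 b_neq0].
rewrite g_sum Num.Theory.normrM.
have : 0 <= (`|a| - 1) * (`|b| - 1) by apply: Num.Theory.mulr_ge0; lia.
have : `|a + b| <= `|a| + `|b| by lia.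
lia.
Qed.

(** The difference [|g| - (|d| + 1)] is [x ^ 3 - 9 x - 10] for [x >= 4] and
    [- x (x + 1) ^ 2] for [x <= -5], and is positive in both cases. *)
Lemma runge_range (x : int) :
  `|x ^+ 3 + x ^+ 2 - 4 * x - 5| <= `|(x + 1) * (x + 4)| + 1 ->
  -4 <= x <= 3.
Proof.
move=> le_gd; apply/andP; split; rewrite Order.TotalTheory.leNgt;
  apply/negP=> x_out.
  have : 0 < - x * (x + 1) ^+ 2 by nia.
  have : 0 <= (x + 1) * (x + 4) by nia.
  nia.
have : 0 < x ^+ 3 - 9 * x - 10 by nia.
have : 0 <= (x + 1) * (x + 4) by nia.
nia.
Qed.

Lemma not_between_squares (n y : int) :
  0 <= n -> n ^+ 2 < y ^+ 2 < (n + 1) ^+ 2 -> False.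
Proof.
move=> n_ge0 /andP[lt_ny lt_yn].
have [y_small|y_large] : `|y| <= n \/ n + 1 <= `|y| by lia.
  by nia.
by nia.
Qed.

Theorem theorem5p2 (x y : int) :
  (y ^+ 2 = x ^+ 6 + 2 * x ^+ 5 - 7 * x ^+ 4 - 18 * x ^+ 3
            + 2 * x ^+ 2 + 20 * x + 9)
  <->
  ((x, y) \in [:: (-1, 1); (-1, -1); (0, 3); (0, -3); (1, 3); (1, -3);
                  (-2, 3); (-2, -3); (-4, 37); (-4, -37)]).
Proof.
split; last first.
  by rewrite !inE; do 9![case/orP=> [/eqP[-> ->] //|]]; move=> /eqP[-> ->].
move=> eq_y.
set g := x ^+ 3 + x ^+ 2 - 4 * x - 5.
set d := (x + 1) * (x + 4).
have eq_gd : y ^+ 2 = g ^+ 2 - 4 * d by rewrite eq_y /g /d; ring.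
have x_range : -4 <= x <= 3.
  have [d0|d_neq0] := eqVneq d 0; last first.
    exact: runge_range (diff_squares_bound d_neq0 eq_gd).
  by move/eqP: d0; rewrite mulf_eq0; clear; lia.
have sqr_root (n : int) : y ^+ 2 = n ^+ 2 -> (y == n) || (y == - n).
  by move/eqP; rewrite eqf_sqr.
have : [|| x == -4, x == -3, x == -2, x == -1, x == 0, x == 1, x == 2 | x == 3].
  by lia.
rewrite !inE !xpair_eqE.
do 7?[case/orP=> [/eqP x_eq|]] => [|||||||/eqP x_eq]; rewrite {}x_eq in eq_y *.
- by have := sqr_root 37 eq_y; lia.
- (* [129] lies strictly between [11 ^ 2] and [12 ^ 2] *)
  by have := @not_between_squares 11 y isT; rewrite eq_y => /(_ isT).
- by have := sqr_root 3 eq_y; lia.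
- by have := sqr_root 1 eq_y; lia.
- by have := sqr_root 3 eq_y; lia.
- by have := sqr_root 3 eq_y; lia.
- (* the sextic takes the value [-71] at [2] *)
  by have := Num.Theory.sqr_ge0 y; rewrite eq_y.
- (* [249] lies strictly between [15 ^ 2] and [16 ^ 2] *)
  by have := @not_between_squares 15 y isT; rewrite eq_y => /(_ isT).
Qed.
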